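(* Let $R$ be an integral domain whose integral closure $R'$ in $\mathrm{qf}(R)$ is local. Then $R$ is a maximal non valuative subring of $R'$ if and only if the following statements hold: (i) $R'$ is a valuation domain. (ii) $R\subset R'$ is a proper extension that is not a pointwise minimal extension. (iii) For each ring $S$ such that $R\subset S\subseteq R'$, either $S = R'$ or $S\subset R'$ is a pointwise minimal extension.
   Context: All rings are commutative with identity and are integral domains; $\mathrm{qf}(R)$ denotes the quotient field of $R$. The symbol $\subset$ denotes proper inclusion. A local ring is a ring with a unique maximal ideal (not necessarily Noetherian). An integral domain $R$ is a valuative domain if for each nonzero $x\in \mathrm{qf}(R)$, at least one of the extensions $R\subseteq R[x]$ and $R\subseteq R[x^{-1}]$ has no ring strictly between its two ends (equality of the two ends is allowed). A proper subring $R$ of an integral domain $T$ is a maximal non valuative subring of $T$ if $R$ is not a valuative domain but every subring of $T$ properly containing $R$ is a valuative domain. A proper ring extension $R\subset T$ is a minimal extension if there is no ring strictly between $R$ and $T$. A proper ring extension $R\subset T$ is a pointwise minimal extension if $R\subset R[x]$ is a minimal extension for each $x\in T\setminus R$. *)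

(* Defs.v *)
From mathcomp Require Import all_boot all_order all_algebra.
From mathcomp Require Import classical_sets.

Set Implicit Arguments.
Unset Strict Implicit.
Unset Printing Implicit Defensive.

Import GRing.Theory.
Local Open Scope classical_set_scope.
Local Open Scope ring_scope.

(* All the rings under consideration live in an ambient field K; they are
   represented by subsets of K closed under the ring operations. *)

Definition subring (K : fieldType) (A : set K) : Prop :=
  GRing.subring_closed (mem A).

Definition qf (K : fieldType) (A : set K) : set K :=
  [set a / b | a in A & b in A `\ 0].

Definition adjoin (K : fieldType) (A : set K) (x : K) : set K :=
  [set p.[x] | p in [set p : {poly K} | p \is a polyOver (mem A)]].

Definition no_ring_strictly_between (K : fieldType) (A B : set K) : Prop :=
  ~ exists C : set K, [/\ subring C, A `<` C & C `<` B].

Definition valuative_domain (K : fieldType) (A : set K) : Prop :=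
  subring A /\
  forall x : K, qf A x -> x != 0 ->
    no_ring_strictly_between A (adjoin A x) \/
    no_ring_strictly_between A (adjoin A x^-1).

Definition proper_extension (K : fieldType) (A B : set K) : Prop :=
  [/\ subring A, subring B & A `<` B].

Definition maximal_non_valuative_subring (K : fieldType) (A B : set K) : Prop :=
  [/\ proper_extension A B,
      ~ valuative_domain A
    & forall C : set K, subring C -> A `<` C -> C `<=` B -> valuative_domain C].

Definition minimal_extension (K : fieldType) (A B : set K) : Prop :=
  proper_extension A B /\ no_ring_strictly_between A B.

Definition pointwise_minimal_extension (K : fieldType) (A B : set K) : Prop :=
  proper_extension A B /\
  forall x : K, (B `\` A) x -> minimal_extension A (adjoin A x).

Definition valuation_domain (K : fieldType) (A : set K) : Prop :=
  subring A /\ forall x : K, qf A x -> x != 0 -> A x \/ A x^-1.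

Definition ideal (K : fieldType) (A I : set K) : Prop :=
  [/\ I `<=` A, I 0,
      forall x y : K, I x -> I y -> I (x + y)
    & forall a x : K, A a -> I x -> I (a * x)].

Definition maximal_ideal (K : fieldType) (A M : set K) : Prop :=
  [/\ ideal A M, M `<` A
    & forall I : set K, ideal A I -> M `<` I -> I = A].

Definition local_ring (K : fieldType) (A : set K) : Prop :=
  subring A /\ exists! M : set K, maximal_ideal A M.

Definition domain_in_qf (R : idomainType) : set {fraction R} :=
  range (@FracField.tofrac R).

Definition integral_closure (R : idomainType) : set {fraction R} :=
  [set x | integralOver (@FracField.tofrac R) x].

Arguments domain_in_qf : clear implicits.
Arguments integral_closure : clear implicits.

(* Main.v *)
(* Write [T] for the integral closure of [R] and [S] for a ring between [R] and
   [T]. As [T] is local, every [S[x]] with [x] in [T] is [S[u]] for some unit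
   [u] of [T], and [S[u] = S[u^-1]] because [u] and [u^-1] are integral over
   [S]. So if [S] is valuative, no ring lies strictly between [S] and [S[x]]
   for any [x] in [T]; when [T] is a valuation domain the converse is immediate.
   It remains to see that [T] is a valuation domain as soon as it is valuative:
   if no ring lies strictly between [T] and [T[y]], then [y^2] is in [T] and [y]
   is integral, or [y] is in [T[y^2]], which makes [y] a root of a polynomial
   over [T] whose coefficient of degree 1 is 1, and then [y] or [y^-1] is in
   [T]. *)
From HB Require Import structures.
Require Import Defs.
From mathcomp Require Import all_boot all_order all_algebra.
From mathcomp Require Import classical_sets boolp.
Set Implicit Arguments.
Unset Strict Implicit.
Unset Printing Implicit Defensive.

Import GRing.Theory.
Local Open Scope classical_set_scope.
Local Open Scope ring_scope.

(** Packs the hypothesis as a canonical structure, so that the library's closure lemmas for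
    [polyOver] and [horner] apply to a bare set. *)
Definition subring_pred (K : fieldType) (A : set K) (sA : subring A) :
    subringClosed K :=
  HB.pack_for (subringClosed K) (fun x : K => x \in A)
    (GRing.isSubringClosed.Build K (mem A) sA).

(** * Subrings of a field and simple extensions *)

Section SubringTheory.
Variables (K : fieldType).
Implicit Types (A B C : set K) (x y u : K) (p : {poly K}).

Lemma subringP A : A 1 -> (forall x y, A x -> A y -> A (x - y)) ->
  (forall x y, A x -> A y -> A (x * y)) -> subring A.
Proof.
move=> A1 AB AM; split=> [|x y|x y]; first exact/mem_set.
  by move=> /set_mem Ax /set_mem Ay; apply/mem_set/AB.
by move=> /set_mem Ax /set_mem Ay; apply/mem_set/AM.
Qed.

Lemma subring1 A : subring A -> A 1.
Proof. by case=> /set_mem. Qed.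

Lemma subringB A x y : subring A -> A x -> A y -> A (x - y).
Proof. by case=> _ AB _ /mem_set Ax /mem_set Ay; apply/set_mem/AB. Qed.

Lemma subringM A x y : subring A -> A x -> A y -> A (x * y).
Proof. by case=> _ _ AM /mem_set Ax /mem_set Ay; apply/set_mem/AM. Qed.

Lemma subring0 A : subring A -> A 0.
Proof.
by move=> sA; have A1 := subring1 sA; rewrite -(subrr 1); apply: (subringB sA).
Qed.

Lemma subringN A x : subring A -> A x -> A (- x).
Proof.
by move=> sA Ax; rewrite -sub0r; apply: (subringB sA) => //; apply: subring0.
Qed.

Lemma subringD A x y : subring A -> A x -> A y -> A (x + y).
Proof.
move=> sA Ax Ay; rewrite -[y]opprK.
by apply: (subringB sA) => //; apply: subringN.
Qed.

Lemma subringX A x n : subring A -> A x -> A (x ^+ n).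
Proof.
move=> sA Ax; elim: n => [|n IHn]; first exact: subring1.
by rewrite exprS; apply: (subringM sA).
Qed.

Lemma subring_sum A (I : Type) (r : seq I) (P : pred I) (F : I -> K) :
  subring A -> (forall i, P i -> A (F i)) -> A (\sum_(i <- r | P i) F i).
Proof.
move=> sA AF; apply: (big_ind A) => //; first exact: subring0.
by move=> x y; apply: (subringD sA).
Qed.

Lemma polyOver_memP A p : subring A ->
  p \is a polyOver (mem A) <-> forall i, A p`_i.
Proof.
move=> sA; split=> [Ap i|Ap]; last first.
  by apply/(@polyOverP _ (subring_pred sA)) => i; apply/mem_set.
by apply/set_mem; have /polyOverP := (Ap : p \is a polyOver (subring_pred sA)).
Qed.

Lemma adjoin_sub A B x : subring B -> A `<=` B -> B x -> adjoin A x `<=` B.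
Proof.
move=> sB AB Bx _ [p Ap <-]; apply/set_mem.
apply: (@rpred_horner _ (subring_pred sB)); last exact/mem_set.
by apply: polyOverS Ap => y /set_mem Ay; apply/mem_set/AB.
Qed.

Lemma adjoin_subset A x : subring A -> A `<=` adjoin A x.
Proof.
move=> sA a Aa; exists a%:P; last by rewrite hornerC.
apply/(polyOver_memP _ sA) => i; rewrite coefC.
by case: ifP => // _; apply: subring0.
Qed.

Lemma adjoin_gen A x : subring A -> adjoin A x x.
Proof.
move=> sA; exists 'X; last by rewrite hornerX.
exact: (polyOverX (subring_pred sA)).
Qed.

Lemma adjoin_subring A x : subring A -> subring (adjoin A x).
Proof.
move=> sA; apply: subringP.
- exact: (adjoin_subset _ sA (subring1 sA)).
- move=> _ _ [p Ap <-] [q Aq <-]; exists (p - q); last by rewrite !hornerE.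
  by have : p - q \is a polyOver (subring_pred sA) by apply: rpredB.
- move=> _ _ [p Ap <-] [q Aq <-]; exists (p * q); last by rewrite !hornerE.
  by have : p * q \is a polyOver (subring_pred sA) by apply: rpredM.
Qed.

Lemma adjoin_id A x : subring A -> A x -> adjoin A x = A.
Proof.
by move=> sA Ax; apply/seteqP; split; [apply: adjoin_sub|apply: adjoin_subset].
Qed.

Lemma adjoin_eq A x y : subring A ->
  adjoin A x y -> adjoin A y x -> adjoin A x = adjoin A y.
Proof.
move=> sA Axy Ayx; apply/seteqP; split; apply: adjoin_sub => //;
  by [apply: adjoin_subring|apply: adjoin_subset].
Qed.

Lemma no_ring_strictly_between_eq A B C : no_ring_strictly_between A B ->
  subring C -> A `<=` C -> C `<=` B -> C = A \/ C = B.
Proof.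
move=> noC sC AC CB; have [->|CA] := pselect (C = A); first by left.
have [->|C_B] := pselect (C = B); first by right.
case: noC; exists C; rewrite !properEneq; split=> //; split=> //; apply/eqP => //.
by move/esym.
Qed.

Lemma no_ring_strictly_between_refl A : no_ring_strictly_between A A.
Proof. by case=> C [_ [_ nCA] [/nCA]]. Qed.

Lemma pointwise_minimal_extensionP A B : proper_extension A B ->
  pointwise_minimal_extension A B <->
  forall x, B x -> no_ring_strictly_between A (adjoin A x).
Proof.
move=> pAB; have [sA sB _] := pAB; split=> [[_ minA] x Bx|noC].
  have [Ax|nAx] := pselect (A x); last by have [] := minA x (conj Bx nAx).
  by rewrite adjoin_id //; apply: no_ring_strictly_between_refl.
split=> // x [Bx nAx]; split; last exact: noC.
split=> //; first exact: adjoin_subring.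
by split=> [|/(_ x (adjoin_gen x sA))//]; apply: adjoin_subset.
Qed.

(* Multiply a monic equation for [u^-1] by a power of [u]. *)
Lemma subring_inv_root A u p : subring A -> u != 0 -> A u ->
  p \is monic -> (forall i, A p`_i) -> root p u^-1 -> A u^-1.
Proof.
move=> sA u0 Au p_monic Ap /rootP.
have : size p != 0 by rewrite size_poly_eq0 monic_neq0.
case sz_p: (size p) => [//|n] _;
rewrite horner_coef sz_p big_ord_recr /=.
have -> : p`_n = 1 by move/monicP: p_monic; rewrite lead_coefE sz_p.
case: n sz_p => [_|n sz_p].
  by rewrite big_ord0 add0r mulr1 => /eqP; rewrite oner_eq0.
(* The exponent is one less than the degree [n.+1]: the leading term becomes [u^-1] and the other
   terms keep nonnegative powers of [u]. *)
rewrite mul1r => /(congr1 (fun y => u ^+ n * y)).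
rewrite mulr0 mulrDr exprSr mulrA -exprMn divff // expr1n mul1r => /eqP.
rewrite addrC addr_eq0 => /eqP ->; apply: (subringN sA) => //.
rewrite mulr_sumr; apply: (subring_sum _ sA) => // i _.
rewrite mulrCA; apply: (subringM sA) => //.
have le_in : (i <= n)%N by rewrite -ltnS.
by rewrite exprVn -expfB_cond ?(negPf u0) ?add0n //; apply: (subringX _ sA).
Qed.

(** One of [x] and [x^-1] lies in [V], and the last hypothesis applies to that one. *)
Lemma valuation_valuative A V : subring A -> valuation_domain V ->
  qf A `<=` qf V ->
  (forall x, V x -> no_ring_strictly_between A (adjoin A x)) ->
  valuative_domain A.
Proof.
move=> sA [_ Vval] qfAV noC; split=> // x /qfAV qfx x0.
by case: (Vval x qfx x0) => /noC; [left|right].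
Qed.

End SubringTheory.

(** * Units of a local ring *)

Section LocalTheory.
Variables (K : fieldType) (T : set K).
Hypothesis T_local : local_ring T.

Lemma nonunit_maximal_ideal x : T x -> ~ (x != 0 /\ T x^-1) ->
  exists2 M, maximal_ideal T M & M x.
Proof.
have [sT _] := T_local => Tx nUx.
pose P I := [/\ ideal T I, I x & ~ I 1].
pose xT := [set a * x | a in T].
have PxT : P xT.
  split; last 1 first.
  - case=> a Ta ax1; apply: nUx.
    have x0 : x != 0.
      by apply: contra_eqN ax1 => /eqP->; rewrite mulr0 eq_sym oner_neq0.
    by split=> //; rewrite -[x^-1]mul1r -ax1 mulfK.
  - split=> [_ [a Ta <-]||_ _ [a Ta <-] [b Tb <-]|a _ Ta [b Tb <-]].
    + exact: (subringM sT).
    + by exists 0; rewrite ?mul0r //; apply: subring0.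
    + by exists (a + b); rewrite ?mulrDl //; apply: (subringD sT).
    + by exists (a * b); rewrite ?mulrA //; apply: (subringM sT).
  - by exists 1; rewrite ?mul1r //; apply: subring1.
(* Zorn's lemma also asks about the empty chain, whose union is empty; hence the alternative
   [I = set0]. *)
have [F FP totF|I [PI maxI]] := @Zorn_bigcup K (fun I => I = set0 \/ P I).
  have [[I [FI PI]]|noI] := pselect (exists I, F I /\ P I); last first.
    left; apply/seteqP; split=> // y [I FI Iy].
    case: (FP I FI) => [I0|PI]; first by rewrite I0 in Iy.
    by case: noI; exists I.
  have PF J y : F J -> J y -> P J by move=> /FP[->|].
  right; split.
  - split.
    + by move=> y [J FJ Jy]; have [[JT _ _ _] _ _] := PF J y FJ Jy; apply: JT.
    + by exists I => //; have [[]] := PI.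
    + move=> y z [J FJ Jy] [L FL Lz].
      have [[_ _ JD _] _ _] := PF J y FJ Jy; have [[_ _ LD _] _ _] := PF L z FL Lz.
      case: (totF J L FJ FL) => sub; [exists L|exists J] => //.
        by apply: LD => //; apply: sub.
      by apply: JD => //; apply: sub.
    + move=> a y Ta [J FJ Jy]; exists J => //.
      by have [[_ _ _ JM] _ _] := PF J y FJ Jy; apply: JM.
  - by exists I => //; case: PI.
  - by case=> J FJ J1; have [] := PF J 1 FJ J1.
(* The maximal element is not empty, since the principal ideal [xT] would be strictly larger. *)
have {}PI : P I.
  case: PI => // I0; case: (maxI xT); last by right.
  by rewrite I0; split=> // /(_ x); case: PxT => _ + _ => /[swap]/[apply].
have [idI Ix I1] := PI; exists I => //; split=> //.
  by split=> [|/(_ 1 (subring1 sT))//]; case: idI.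
move=> J idJ IJ; have [JT _ _ JM] := idJ; apply/seteqP; split=> // y Ty.
have [J1|nJ1] := pselect (J 1); first by rewrite -[y]mulr1; apply: JM.
by case: (maxI J IJ); right; split=> //; apply: (properW IJ).
Qed.

(** Two nonunits would both lie in the unique maximal ideal, which would then contain their sum, a
    unit, and so the whole ring. *)
Lemma local_unit_add x y : T x -> T y -> x + y != 0 -> T (x + y)^-1 ->
  (x != 0 /\ T x^-1) \/ (y != 0 /\ T y^-1).
Proof.
move=> Tx Ty xy0 Uxy; apply: contrapT => /not_orP[nUx nUy].
have [M Mmax Mx] := nonunit_maximal_ideal Tx nUx.
have [N Nmax Ny] := nonunit_maximal_ideal Ty nUy.
have [_ [M0 [_ M0u]]] := T_local.
have [[MT _ MD MM] [_ TM] _] := Mmax.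
have Mxy : M (x + y) by apply: MD => //; rewrite -(M0u _ Mmax) (M0u _ Nmax).
apply: TM => z Tz; rewrite -(mulfVK xy0 z).
by have [sT _] := T_local; apply: (MM _ _ _ Mxy); apply: (subringM sT).
Qed.

(** Since [1 + x] and [- x] add up to 1, one of them is a unit, and each generates the same
    extension as [x]. *)
Lemma local_unit_adjoin x : T x -> exists u, [/\ u != 0, T u, T u^-1 &
  forall A, subring A -> adjoin A x = adjoin A u].
Proof.
have [sT _] := T_local; move=> Tx.
have T1x := subringD sT (subring1 sT) Tx.
have e1 : (1 + x) + - x = 1 by rewrite addrK.
case: (local_unit_add T1x (subringN sT Tx)).
- by rewrite e1 oner_neq0.
- by rewrite e1 invr1; apply: subring1.
- case=> u0 Uu; exists (1 + x); split=> // A sA.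
  have sAy y := adjoin_subring y sA; have gen y := adjoin_gen y sA.
  apply: adjoin_eq => //; first exact: (subringD (sAy _) (subring1 (sAy _))).
  have := subringB (sAy _) (gen (1 + x)) (subring1 (sAy _)).
  by rewrite addrAC subrr add0r.
case=> u0 Uu; exists (- x); split=> //; first exact: subringN.
move=> A sA; have sAy y := adjoin_subring y sA; have gen y := adjoin_gen y sA.
apply: adjoin_eq => //; first exact: (subringN (sAy _)).
by have := subringN (sAy _) (gen (- x)); rewrite opprK.
Qed.

End LocalTheory.

(** * Integrally closed local rings *)

Section IntegrallyClosed.
Variables (K : fieldType) (T : set K).
Hypothesis T_local : local_ring T.
Hypothesis T_closed : forall (p : {poly K}) x,
  p \is monic -> (forall i, T p`_i) -> root p x -> T x.
Let sT : subring T. Proof. by case: T_local. Qed.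

(** With [a] the coefficient of the top degree [d], multiplying the equation of [x] by [a^(d-1)]
    gives a monic equation for [a * x] over [T]. *)
Lemma lead_coef_mul_root n (p : {poly K}) x :
  (size p <= n.+1)%N -> (forall i, T p`_i) -> root p x -> T (p`_n * x).
Proof.
move=> sz_p Tp /rootP; rewrite (horner_coef_wide x sz_p) big_ord_recr /=.
set a := p`_n; have Ta : T a by apply: Tp.
case: n => [|n] in sz_p a Ta *.
  by rewrite big_ord0 add0r mulr1 => ->; rewrite mul0r; apply: subring0.
move=> px0; pose r := \poly_(i < n.+1) (p`_i * a ^+ (n - i)).
have sz_r : (size r < size ('X^(n.+1) : {poly K}))%N.
  by rewrite size_polyXn ltnS size_poly.
apply: (T_closed (p := 'X^(n.+1) + r)).
- by rewrite monicE lead_coefDl // lead_coefXn.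
- move=> i; rewrite coefD coefXn coef_poly; apply: (subringD sT).
    by case: eqP => _; [apply: subring1|apply: subring0].
  case: ifP => _; last exact: subring0.
  by apply: (subringM sT) => //; apply: (subringX _ sT).
rewrite rootE hornerD hornerXn horner_poly; apply/eqP.
apply: etrans (etrans (congr1 ( *%R (a ^+ n)) px0) (mulr0 _)).
rewrite mulrDr addrC; congr (_ + _).
  rewrite mulr_sumr; apply: eq_bigr => i _.
  have -> : a ^+ n = a ^+ (n - i) * a ^+ i by rewrite -exprD subnK // -ltnS.
  by rewrite exprMn [RHS]mulrACA [_ * p`_i]mulrC.
by rewrite exprMn exprSr mulrA.
Qed.

(* Descending on the degree, [a x^(n+2)] is absorbed into the next coefficient
   as [(a x) x^(n+1)], where [a x] is again in [T]. *)
Lemma unit_coef_root n (p : {poly K}) x :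
    (size p <= n.+2)%N -> (forall i, T p`_i) -> p`_1 != 0 -> T (p`_1)^-1 ->
  root p x -> T x \/ T x^-1.
Proof.
elim: n p => [|n IHn] p sz_p Tp p1 Up1 px0.
  left; move/rootP: px0; rewrite (horner_coef_wide x sz_p).
  rewrite !big_ord_recr big_ord0 /= add0r mulr1 expr1 => /eqP.
  rewrite addrC addr_eq0 => /eqP p1x.
  rewrite -[x](mulKf p1) p1x; apply: (subringM sT) => //.
  exact: subringN.
have Tb := lead_coef_mul_root sz_p Tp px0.
set a := p`_n.+2 in Tb; set b := a * x in Tb.
have Ta : T a by apply: Tp.
have [[a0 Ua]|nUa] := pselect (a != 0 /\ T a^-1).
  by left; rewrite -[x](mulKf a0); apply: (subringM sT).
(* If [b = a * x] is a unit then [x^-1 = a / b]; from here on [b] may be taken to be a nonunit. *)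
have [[b0 Ub]|nUb] := pselect (b != 0 /\ T b^-1).
  right; have : a != 0 by apply: contraNneq b0; rewrite /b => ->; rewrite mul0r.
  move=> a0; have -> : x^-1 = a / b by rewrite /b invfM mulVKf.
  by apply: (subringM sT).
(* The degree 1 coefficient changes only when [n = 0], where it becomes [p_1 + b]. This is still a
   unit: [p_1 = (p_1 + b) - b] is one and [b] is not. *)
pose q := \poly_(i < n.+2) (p`_i + b *+ (i == n.+1)).
have [q1 Uq1] : q`_1 != 0 /\ T (q`_1)^-1.
  rewrite coef_poly /= eqSS; case: (0%N =P n) => _; last by rewrite mulr0n addr0.
  rewrite mulr1n; have : p`_1 = (p`_1 + b) + - b by rewrite addrK.
  move=> e; rewrite e in p1 Up1.
  have Tpb : T (p`_1 + b) by apply: (subringD sT).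
  case: (local_unit_add T_local Tpb (subringN sT Tb) p1 Up1) => // -[].
  rewrite oppr_eq0 invrN => b0 /(subringN sT); rewrite opprK => Ub.
  by case: nUb.
apply: (IHn q) => //; first exact: size_poly.
  move=> i; rewrite coef_poly; case: ifP => _; last exact: subring0.
  apply: (subringD sT) => //.
  by case: (i == _); [|apply: subring0].
apply/rootP; rewrite horner_poly; move/rootP: px0.
rewrite (horner_coef_wide x sz_p) big_ord_recr /= => /(etrans _); apply.
under eq_bigr do rewrite mulrDl.
rewrite big_split; congr (_ + _).
rewrite (bigD1 ord_max) //= eqxx mulr1n big1 ?addr0.
  by rewrite /b -mulrA -exprS.
by move=> i; rewrite -val_eqE /= => /negPf ->; rewrite mul0r.
Qed.

Lemma valuative_local_valuation : valuative_domain T -> valuation_domain T.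
Proof.
move=> [_ Tval]; split=> // x qfx x0.
suff noC y : no_ring_strictly_between T (adjoin T y) -> T y \/ T y^-1.
  by case: (Tval x qfx x0) => /noC //; rewrite invrK; case; [right|left].
move=> noC; have sTy := adjoin_subring y sT; have Tyy := adjoin_gen y sT.
have y2 : adjoin T y (y ^+ 2) by apply: (subringX _ sTy).
case: (no_ring_strictly_between_eq noC (adjoin_subring (y ^+ 2) sT)).
- exact: adjoin_subset.
- by apply: adjoin_sub => //; apply: adjoin_subset.
- move=> Ty2; left; apply: (T_closed (p := 'X^2 - (y ^+ 2)%:P)).
  + exact: monicXnsubC.
  + have {}Ty2 : T (y ^+ 2) by rewrite -Ty2; apply: adjoin_gen.
    move=> i; rewrite coefB coefXn coefC.
    apply: (subringB sT); case: eqP => _ //;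
      by [apply: subring1|apply: subring0].
  + by rewrite rootE !hornerE subrr.
move=> Ty2; have [g Tg gy] : adjoin T (y ^+ 2) y by rewrite Ty2.
have {}Tg : forall i, T g`_i by apply/(polyOver_memP _ sT).
(* Only even powers occur in [g \Po 'X^2], so the coefficient of degree 1 comes from ['X] alone. *)
pose p := 'X - (g \Po 'X^2).
have p1 : p`_1 = 1 by rewrite coefB coefX coef_comp_poly_Xn //= subr0.
apply: (@unit_coef_root (size p) p).
- by rewrite ltnW // ltnW.
- move=> i; rewrite coefB coefX coef_comp_poly_Xn //.
  apply: (subringB sT); last by case: ifP => // _; apply: subring0.
  by case: eqP => _; [apply: subring1|apply: subring0].
- by rewrite p1 oner_neq0.
- by rewrite p1 invr1; apply: subring1.
by rewrite rootE !hornerE horner_comp hornerXn gy subrr.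
Qed.

End IntegrallyClosed.

(** * Rings between a domain and its integral closure *)

Section IntegralClosure.
Variable R : idomainType.
Local Notation D := (domain_in_qf R).
Local Notation T := (integral_closure R).
Implicit Types (S : set {fraction R}) (x u : {fraction R}).

(** All the rings above the domain share the ambient fraction field as quotient field, so the
    condition on [qf] in the definitions is automatic for them. *)
Lemma qf_full S x : D `<=` S -> qf S x.
Proof.
move=> DS; elim/generic_quotient.quotW: x => r.
have d0 := denom_ratioP r.
exists (FracField.tofrac (val r).1); first by apply: DS; exists (val r).1.
exists (FracField.tofrac (val r).2).
  split; first by apply: DS; exists (val r).2.
  by move/eqP; rewrite tofrac_eq0 (negPf d0).
(* With the denominator cleared, both sides are classes of pairs and are compared by cross
   multiplication. *)
apply/eqP; rewrite eq_sym -(can2_eq (mulfK _) (mulfVK _)) ?tofrac_eq0 //.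
unlock FracField.tofrac; rewrite -[_ * _]FracField.pi_mul.
rewrite FracField.equivf_def /FracField.mulf /=.
rewrite !numden_Ratio ?oner_neq0 ?mulr1 //.
by rewrite mulrC.
Qed.

Lemma integral_closure_closed (p : {poly {fraction R}}) x :
  p \is monic -> (forall i, T p`_i) -> root p x -> T x.
Proof.
move=> p_monic Tp px0.
by apply: integral_root_monic p_monic px0 _; apply/integral_poly.
Qed.

Lemma domain_sub_integral_closure : D `<=` T.
Proof. by move=> _ [a _ <-]; apply: integral_id. Qed.

(** Used with [S] replaced by [S[u]] and by [S[u^-1]], to show that these two rings coincide. *)
Lemma integral_inv_mem S u : subring S -> D `<=` S -> u != 0 ->
  S u -> T u^-1 -> S u^-1.
Proof.
move=> sS DS u0 Su [p p_monic pu0].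
apply: (subring_inv_root sS u0 Su _ _ pu0); first exact: monic_map.
by move=> i; rewrite coef_map; apply: DS; exists p`_i.
Qed.

Hypothesis T_local : local_ring T.

(* [x] may be replaced by a unit [u] of [T] with [S[u] = S[x]]; then
   [S[u] = S[u^-1]], so the two alternatives of valuativity agree. *)
Lemma valuative_no_ring_between S x : D `<=` S ->
  valuative_domain S -> T x -> no_ring_strictly_between S (adjoin S x).
Proof.
have [sT _] := T_local; move=> DS [sS Sval] Tx.
suff [u [u0 Tu TVu Uu]] : exists u,
    [/\ u != 0, T u, T u^-1 & adjoin S x = adjoin S u].
  have Uadj : adjoin S u = adjoin S u^-1.
    have subS y : D `<=` adjoin S y by move=> z /DS; apply: adjoin_subset.
    have sSu y := adjoin_subring y sS; have gen y := adjoin_gen y sS.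
    apply: adjoin_eq => //; first exact: integral_inv_mem.
    by rewrite -[X in _ X]invrK; apply: integral_inv_mem; rewrite ?invr_eq0 ?invrK.
  by rewrite Uu; case: (Sval u (qf_full _ DS) u0) => //; rewrite -Uadj.
by have [u [u0 Tu TVu /(_ S sS)]] := local_unit_adjoin T_local Tx; exists u.
Qed.

End IntegralClosure.

Theorem theorem2p11 (R : idomainType)
    (hlocal : local_ring (integral_closure R)) :
  maximal_non_valuative_subring (domain_in_qf R) (integral_closure R) <->
  [/\ valuation_domain (integral_closure R),
      proper_extension (domain_in_qf R) (integral_closure R) /\
      ~ pointwise_minimal_extension (domain_in_qf R) (integral_closure R)
    & forall S : set {fraction R}, subring S ->
        domain_in_qf R `<` S -> S `<=` integral_closure R ->
        S = integral_closure R \/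
        pointwise_minimal_extension S (integral_closure R)].
Proof.
have [sT _] := hlocal; have DT := @domain_sub_integral_closure R.
split=> [[pDT nvalD valC]|[valT [pDT npmD] pmC]].
  have [sD _ ltDT] := pDT.
  (* The integral closure is itself one of the rings properly containing the domain, hence
     valuative. *)
  have valT : valuation_domain (integral_closure R).
    apply: valuative_local_valuation => //; first exact: integral_closure_closed.
    exact: valC.
  split=> //; first split=> // /(pointwise_minimal_extensionP pDT) noC.
    apply: nvalD; apply: (valuation_valuative sD valT) => // x _.
    exact: qf_full.
  move=> S sS DS ST; have [->|neST] := pselect (S = integral_closure R).
    by left.
  have pST : proper_extension S (integral_closure R).
    by split=> //; rewrite properEneq; split=> //; apply/eqP.
  right; apply/(pointwise_minimal_extensionP pST) => x.
  by apply: valuative_no_ring_between => //; [apply: properW|apply: valC].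
have [sD _ ltDT] := pDT.
have qfT (S : set {fraction R}) : qf S `<=` qf (integral_closure R).
  by move=> x _; apply: qf_full.
split=> // [valD|S sS DS ST].
  (* Were the domain valuative, the absence of intermediate rings would make the extension pointwise
     minimal, against (ii). *)
  by apply: npmD; apply/(pointwise_minimal_extensionP pDT) => x;
    apply: valuative_no_ring_between.
apply: (valuation_valuative sS valT) => // x.
have [->|pmS] := pmC S sS DS ST.
  by move=> Tx; rewrite adjoin_id //; apply: no_ring_strictly_between_refl.
by have [pST _] := pmS; move/(pointwise_minimal_extensionP pST): pmS; apply.
Qed.
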